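(* Consider a multiclass queueing network with $K=4$ queues, partitioned into two groups of two queues, $\mathcal{G}_1=\{1,2\}$ and $\mathcal{G}_2=\{3,4\}$, with arbitrary routing matrix $\mathbf{R}$ such that the network is open, exogenous arrival rate vector $\boldsymbol{\lambda}$ and service rate vector $\boldsymbol{\mu}$. Suppose that the utilization condition holds: there is $\epsilon>0$ such that $$\sum_{i\in\mathcal{G}_j}\frac{\nu_i}{\mu_i}\le 1-\epsilon\qquad\text{for } j=1,2,$$ where $\boldsymbol{\nu}=(\mathbf{I}-\mathbf{R}^T)^{-1}\boldsymbol{\lambda}$. Then the network is stable under longest-queue (LQ) scheduling; that is, its LQ fluid model is stable: there exists $\delta>0$ such that every LQ fluid solution $(\mathbf{X},\mathbf{T})$ with $\|\mathbf{X}(0)\|\le 1$ satisfies $\mathbf{X}(t)=\mathbf{0}$ for all $t>\delta$.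
   Context: Network data. $\mathbf{R}=(r_{ik})$ is a $K\times K$ matrix with $r_{ik}\ge 0$ and $\sum_k r_{ik}\le 1$; $r_{ik}$ is the probability that a job leaving queue $i$ goes to queue $k$ (with probability $1-\sum_k r_{ik}$ it leaves the network). The network is open: all jobs eventually leave, i.e. the series $\mathbf{I}+\mathbf{R}^T+(\mathbf{R}^T)^2+\cdots$ converges, and equals $(\mathbf{I}-\mathbf{R}^T)^{-1}$. The exogenous arrival rates are $\lambda_i\ge 0$ and the service rates are $\mu_i>0$, $i=1,\dots,K$. The queues are partitioned into disjoint groups $\mathcal{G}_1,\dots,\mathcal{G}_J$; in each group only one queue can be served at a time (here $K=4$, $J=2$). Under LQ scheduling, the longest queue in each group is served, with ties broken arbitrarily. LQ fluid model. A fluid solution is a pair of functions $\mathbf{X},\mathbf{T}:[0,\infty)\to[0,\infty)^K$, where $X_k(t)$ is the fluid level of queue $k$ and $T_k(t)$ is the cumulative time that queue $k$ has been served up to time $t$. Each $T_k$ is nondecreasing with $T_k(0)=0$, and $\sum_{i\in\mathcal{G}_j}(T_i(t)-T_i(s))\le t-s$ for all $0\le s\le t$ and all $j$. For all $t\ge 0$, $$X_k(t)=X_k(0)+\lambda_k t-\mu_kT_k(t)+\sum_{i=1}^K r_{ik}\mu_iT_i(t),\qquad k=1,\dots,K.$$ Let $S_j(t)=\{i\in\mathcal{G}_j: X_i(t)=\max_{k\in\mathcal{G}_j}X_k(t)\}$. An LQ fluid solution satisfies in addition, at every $t>0$ at which all the $T_i$ are differentiable, for every group $j$ with $\max_{k\in\mathcal{G}_j}X_k(t)>0$,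 $$\sum_{i\in S_j(t)}\dot T_i(t)=1,\qquad \sum_{i\in\mathcal{G}_j\setminus S_j(t)}\dot T_i(t)=0.$$ *)

(* Defs.v *)
From mathcomp Require Import all_boot all_order all_algebra.
From mathcomp Require Import all_classical all_reals all_analysis.

Set Implicit Arguments.
Unset Strict Implicit.
Unset Printing Implicit Defensive.

Import Order.TTheory GRing.Theory Num.Theory.
Import numFieldNormedType.Exports.
Local Open Scope ring_scope.

Definition routing_matrix (R : realType) (K : nat) (r : 'M[R]_K) : Prop :=
  (forall i k, 0 <= r i k) /\ (forall i, \sum_(k < K) r i k <= 1).

Definition open_network (R : realType) (K : nat) (r : 'M[R]_K) : Prop :=
  cvgn (series (fun n : nat => r^T ^+ n)).

(* [nu]; [invmx] is the genuine inverse here, since [1%:M - r^T] is invertible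
   whenever the network is open. *)
Definition total_rate (R : realType) (K : nat) (r : 'M[R]_K)
    (lambda : 'cV[R]_K) : 'cV[R]_K :=
  invmx (1%:M - r^T) *m lambda.

Definition utilization_condition (R : realType) (K J : nat) (r : 'M[R]_K)
    (lambda mu : 'cV[R]_K) (G : 'I_J -> {set 'I_K}) : Prop :=
  exists2 eps : R, 0 < eps &
    forall j, \sum_(i in G j) total_rate r lambda i 0 / mu i 0 <= 1 - eps.

(* Functions on [0, oo) are represented by functions on [R] whose values at
   negative times are irrelevant. *)
Record fluid_solution (R : realType) (K J : nat) (r : 'M[R]_K)
    (lambda mu : 'cV[R]_K) (G : 'I_J -> {set 'I_K})
    (X T : R -> 'cV[R]_K) : Prop := FluidSolution {
  fluid_level_ge0 : forall t k, 0 <= t -> 0 <= X t k 0;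
  fluid_time_ge0 : forall t k, 0 <= t -> 0 <= T t k 0;
  fluid_time_ndecr : forall s t k, 0 <= s -> s <= t -> T s k 0 <= T t k 0;
  fluid_time0 : forall k, T 0 k 0 = 0;
  fluid_capacity : forall j s t, 0 <= s -> s <= t ->
    \sum_(i in G j) (T t i 0 - T s i 0) <= t - s;
  fluid_balance : forall t k, 0 <= t ->
    X t k 0 = X 0 k 0 + lambda k 0 * t - mu k 0 * T t k 0
              + \sum_(i < K) r i k * mu i 0 * T t i 0
}.

(* Base value 0 for the maximum: fluid levels are nonnegative. *)
Definition group_max (R : realType) (K : nat) (A : {set 'I_K})
    (x : 'cV[R]_K) : R :=
  \big[Num.max/0]_(k in A) x k 0.

Definition longest_queues (R : realType) (K : nat) (A : {set 'I_K})
    (x : 'cV[R]_K) : {set 'I_K} :=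
  [set i in A | x i 0 == group_max A x]%SET.

Definition lq_fluid_solution (R : realType) (K J : nat) (r : 'M[R]_K)
    (lambda mu : 'cV[R]_K) (G : 'I_J -> {set 'I_K})
    (X T : R -> 'cV[R]_K) : Prop :=
  fluid_solution r lambda mu G X T /\
  forall t : R, 0 < t ->
    (forall i, derivable (fun s : R => T s i 0) t 1) ->
    forall j, 0 < group_max (G j) (X t) ->
      \sum_(i in longest_queues (G j) (X t)) derive1 (fun s : R => T s i 0) t = 1 /\
      \sum_(i in G j :\: longest_queues (G j) (X t))
        derive1 (fun s : R => T s i 0) t = 0.

(* The norm on ['cV[R]_K] is the maximum norm. *)
Definition lq_fluid_stable (R : realType) (K J : nat) (r : 'M[R]_K)
    (lambda mu : 'cV[R]_K) (G : 'I_J -> {set 'I_K}) : Prop :=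
  exists2 delta : R, 0 < delta &
    forall X T : R -> 'cV[R]_K, lq_fluid_solution r lambda mu G X T ->
      `|X 0| <= 1 -> forall t : R, delta < t -> X t = 0.

(* The groups {1,2} and {3,4}, with queues numbered from 0. *)
Definition two_pairs (j : 'I_2) : {set 'I_4} :=
  if j == 0 then [set i : 'I_4 | (i < 2)%N]%SET
  else [set i : 'I_4 | (2 <= i)%N]%SET.

(* Main.v *)
Require Import Defs.
From HB Require Import structures.
From mathcomp Require Import all_boot all_order all_algebra.
From mathcomp Require Import all_classical all_reals all_analysis.
From mathcomp Require Import ring lra.
Import Order.TTheory GRing.Theory Num.Theory.
Import numFieldNormedType.Exports.
Set Implicit Arguments.
Unset Strict Implicit.
Unset Printing Implicit Defensive.
Local Open Scope ring_scope.

(** Let [V_j x] be the sum over group [j] of [((I - R^T)^-1 x)_i / mu_i]: the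
    time group [j] still has to work on the fluid [x].  Along a fluid solution
    [V_j] has derivative [rho_j - (fraction of time group j works)], so it
    decreases at rate at least [eps] whenever group [j] is nonempty.  The
    Lyapunov function is [max (a V_1) (b V_2)], where [a], [b] are chosen so that
    [a V_1 < b V_2] on the indicator of group 2 and [a V_1 > b V_2] on that of
    group 1; such weights exist because
    [V_1(1_{G_1}) V_2(1_{G_2}) > V_1(1_{G_2}) V_2(1_{G_1})].
    The critical case is that group 1 is empty and [a V_1 >= b V_2].  The two
    levels of group 2 are then unequal, and the shorter queue is not served, so
    it grows while the longer one shrinks.  The sign pattern of [a V_1 - b V_2]
    on group 2 shows that this quantity does not increase, so [a V_1] decreases
    at least as fast as [b V_2].
    The service times are Lipschitz, hence differentiable almost everywhere, and
    a nonnegative Lipschitz function with right drift [<= -c] at almost every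
    point where it is positive reaches 0 in finite time and stays there. *)

(** * Lipschitz functions of one variable *)

Lemma wlength_ocitv_le (R : realType) (f : cumulative R R)
    (A : set (ocitv_type R)) :
  (forall s t, s <= t -> f t - f s <= t - s) -> ocitv A ->
  (wlength f A <= wlength (@idfun R) A)%E.
Proof.
move=> f1 /ocitvP[->|[[a b]/= ab ->]]; first by rewrite !wlength0.
by rewrite !wlength_itv_bnd ?lee_fin ?f1// ltW.
Qed.

(** Both sides are infima over the same countable covers by half-open intervals, and the lengths
    compare term by term. *)
Lemma lebesgue_stieltjes_measure_le (R : realType) (f : cumulative R R)
    (A : set R) :
  (forall s t, s <= t -> f t - f s <= t - s) ->
  (lebesgue_stieltjes_measure f A <= lebesgue_measure A)%E.
Proof.
move=> f1; rewrite /lebesgue_measure /lebesgue_stieltjes_measure.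
rewrite /measure_extension /mu_ext.
apply: le_ereal_inf_tmp => _ [B [mB AB] <-].
apply: ge_ereal_inf.
exists (\sum_(0 <= k <oo) wlength f (B k))%E; first by exists B.
apply: lee_nneseries => [k *|k *]; first exact: wlength_ge0.
by apply: wlength_ocitv_le => //; exact: mB.
Qed.


Lemma lipschitz_nondecreasing_derivable_ae (R : realType) (T : R -> R) (M : R) :
  0 < M ->
  (forall s t : R, 0 <= s -> s <= t -> T s <= T t /\ T t - T s <= t - s) ->
  lebesgue_measure.-negligible [set t | 0 < t < M /\ ~ derivable T t 1].
Proof.
(* Nothing is assumed of [T] at negative times; freezing it there at [T 0] makes it monotone on the
   whole line. *)
move=> M0 T1; pose F (t : R) := T (Num.max 0 t).
have F1 s t : s <= t -> F s <= F t /\ F t - F s <= t - s.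
  move=> st; have [] := T1 (Num.max 0 s) (Num.max 0 t).
  - by rewrite le_max lexx.
  - by rewrite ge_max !le_max lexx st orbT.
  - rewrite /F => -> h; split => //; apply: (le_trans h).
    case: (leP 0 s) => s0; case: (leP 0 t) => t0; lra.
have Fnd : {homo F : x y / x <= y} by move=> x y /F1[].
have Frc : right_continuous F.
  move=> x; apply/cvgrPdist_le => /= e e0.
  near=> y; have xy : x <= y by near: y; exact: nbhs_right_ge.
  rewrite distrC ger0_norm ?subr_ge0; last exact: Fnd.
  apply: (le_trans (F1 _ _ xy).2); rewrite lerBlDl.
  by near: y; apply: nbhs_right_le; rewrite ltrDl.
pose Fc : cumulative R R := HB.pack F (isCumulative.Build R _ R F Fnd Frc).
pose D : set (measurableTypeR R) := `]0, M]%classic.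
have mD : @measurable _ (measurableTypeR R) D by exact: measurable_itv.
have FD t : 0 <= t ->
    (lebesgue_stieltjes_measure Fc `]0%R, t]%classic = (F t - F 0)%:E)%E.
  move=> t0; rewrite /lebesgue_stieltjes_measure /measure_extension.
  rewrite measurable_mu_extE/=; last exact: is_ocitv.
  by rewrite wlength_itv_bnd.
have Doo : (lebesgue_stieltjes_measure Fc D < +oo)%E by rewrite FD ?ltry// ltW.
(* The Stieltjes measure of [T] is dominated by the Lebesgue measure; its density
   is the derivative almost everywhere. *)
pose nu : {finite_measure set (measurableTypeR R) -> \bar R} :=
  mfrestr mD Doo.
pose mu : {sigma_finite_measure set (measurableTypeR R) -> \bar R} :=
  @lebesgue_measure R.
have nule : nu `<< mu.
  apply/null_content_dominatesP => A mA A0.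
  apply/eqP; rewrite eq_le measure_ge0 andbT -A0 /nu /mfrestr /mrestr.
  apply: (@le_trans _ _ (lebesgue_measure (A `&` D))).
    by apply: lebesgue_stieltjes_measure_le => s t /F1[].
  by apply: le_measure; rewrite ?inE//; exact: measurableI.
have [f [f0 ffin fint nuf]] := radon_nikodym_sigma_finite nule.
pose g := fine \o f.
have gint : lebesgue_measure.-integrable setT (EFin \o g).
  by apply: eq_integrable fint => // x _ /=; rewrite fineK.
have gloc : locally_integrable setT g.
  by apply: open_integrable_locally => //; exact: openT.
have gitv y : lebesgue_measure.-integrable
    [set` Interval (BRight (0:R)) (BRight y)] (EFin \o g).
  exact: integrableS gint.
have /= := FTC1 gitv gloc.
move=> [N [mN N0 NP]]; exists N; split => //.
move=> t /= [/andP[t0 tM] nd]; apply: NP => /= h.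
apply: nd; have [+ _] := h t0.
(* [G] integrates the density from 0. It is identified with [T - T 0] on [[0, M]] only, because [nu]
   is restricted to [D]; this suffices near a point strictly inside. *)
set G := (fun _ => _).
have GE x : 0 <= x <= M -> G x = T x - T 0.
  move=> /andP[x0 xM]; rewrite /G /Rintegral.
  rewrite (@eq_integral _ _ _ _ _ f) => [|y _]; last by rewrite /g/= fineK.
  rewrite -nuf//= /nu/= /mfrestr /mrestr.
  rewrite (_ : setI _ _ = `]0, x]%classic); last first.
    apply/seteqP; split => y /=; rewrite !in_itv/=; first by case.
    by move=> /andP[y0 yx]; split; apply/andP; split => //; exact: le_trans xM.
  by rewrite FD// /F/= max_r// max_l.
move=> dG.
suff : derivable (fun x => G x + T 0) t 1.
  apply: near_eq_derivable.
  near=> x; rewrite GE ?subrK//; apply/andP; split; near: x.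
    exact: lt_le_nbhsr.
  exact: lt_le_nbhsl.
by apply: (derivableD dG); exact: derivable_cst.
Unshelve. all: by end_near.
Qed.

(** If [h a < h b], take the last point [c] where [h] is at most a level [v] strictly between them:
    the one-sided bound at [c] carries [h <= v] past [c]. Since [h a < v], [c] differs from [a],
    where no such bound is assumed. *)
Lemma lipschitz_le_of_right_le (R : realType) (h : R -> R) (K a b : R) :
  a < b ->
  (forall s t : R, a <= s -> s <= t -> t <= b -> `|h t - h s| <= K * (t - s)) ->
  (forall t : R, a < t < b ->
     exists2 d, 0 < d & forall u, t < u < t + d -> h u <= h t) ->
  h b <= h a.
Proof.
move=> ab hK hd; rewrite leNgt; apply/negP => hab.
have K0 : 0 <= K.
  have := hK _ _ (lexx a) (ltW ab) (lexx b).
  move=> /(le_trans (normr_ge0 _)); rewrite pmulr_lge0 ?subr_gt0//.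
have [v vE] : exists v, v = (h a + h b) / 2 by exists ((h a + h b) / 2).
have av : h a < v by lra.
have vb : v < h b by lra.
(* [K] may be 0, hence the denominators [K + 1]. *)
have K1 : 0 < K + 1 by lra.
pose E := [set x | a <= x <= b /\ h x <= v]%classic.
have Ea : E a by split; [lra|exact: ltW].
have Eub : ubound E b by move=> x [/andP[]].
have hub : has_ubound E by exists b.
have Esup : has_sup E by split; [exists a|exists b].
pose c := sup E.
have ac : a <= c by exact: (ub_le_sup hub).
have cb : c <= b by apply: ge_sup => //; exists a.
have hc : h c <= v.
  rewrite leNgt; apply/negP => vc.
  have d0 : 0 < (h c - v) / (K + 1) by rewrite divr_gt0// subr_gt0.
  have [x [/andP[ax xb] hx]] := sup_adherent d0 Esup; rewrite -/c => xc.
  have xlec : x <= c by apply: (ub_le_sup hub) => //; split => //; exact/andP.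
  have := le_trans (ler_norm _) (hK _ _ ax xlec cb).
  have : (K + 1) * (c - x) < h c - v by rewrite mulrC -ltr_pdivlMr//; lra.
  nra.
have ltac : a < c.
  pose d := Num.min (b - a) ((v - h a) / (K + 1)).
  have d0 : 0 < d by rewrite lt_min subr_gt0 ab/= divr_gt0// subr_gt0.
  have d1 : d <= b - a by rewrite ge_min lexx.
  have d2 : d * (K + 1) <= v - h a by rewrite -ler_pdivlMr// ge_min lexx orbT.
  suff : E (a + d) by move=> /(ub_le_sup hub); rewrite -/c; lra.
  split; first lra.
  have := le_trans (ler_norm _) (hK a (a + d) (lexx a) ltac:(lra) ltac:(lra)).
  nra.
have ltcb : c < b.
  by rewrite lt_neqAle cb andbT; apply: contraTneq hc => ->; rewrite -ltNge.
have [d d0 hd'] := hd c ltac:(apply/andP; split => //).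
pose u := Num.min (c + d / 2) b.
have cu : c < u by rewrite lt_min ltcb andbT; lra.
have ud : u <= c + d / 2 by rewrite ge_min lexx.
have ub : u <= b by rewrite ge_min lexx orbT.
have : E u.
  split; first lra.
  by apply: le_trans hc; apply: hd'; lra.
by move=> /(ub_le_sup hub); rewrite -/c; lra.
Qed.

(** This isolates the stretch before [t0] on which [f] stays positive, so that a drift bound assumed
    only where [f > 0] applies throughout. The point [s] is the supremum of the zeros up to [t0],
    with 0 adjoined in case there is none. *)
Lemma last_zero (R : realType) (f : R -> R) (K t0 : R) :
  0 < t0 -> 0 < f t0 ->
  (forall t : R, 0 <= t -> 0 <= f t) ->
  (forall s t : R, 0 <= s -> s <= t -> `|f t - f s| <= K * (t - s)) ->
  exists s, [/\ 0 <= s, s < t0, s = 0 \/ f s = 0 &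
    forall x, s < x <= t0 -> 0 < f x].
Proof.
move=> t00 ft0 f0 fK.
have K0 : 0 <= K.
  have := fK _ _ (lexx 0) (ltW t00).
  move=> /(le_trans (normr_ge0 _)); rewrite pmulr_lge0 ?subr_gt0//.
pose Z := [set x | 0 <= x <= t0 /\ (x = 0 \/ f x = 0)]%classic.
have Z0 : Z 0 by split; [lra|left].
have Zub : ubound Z t0 by move=> x [/andP[]].
have hub : has_ubound Z by exists t0.
have Zsup : has_sup Z by split; [exists 0|exists t0].
pose s := sup Z.
have s0 : 0 <= s by exact: (ub_le_sup hub).
have st : s <= t0 by apply: ge_sup => //; exists 0.
have sZ : s = 0 \/ f s = 0.
  have [->|sn0] := eqVneq s 0; first by left.
  right; apply/eqP; rewrite eq_le f0// andbT leNgt; apply/negP => fs.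
  pose d := Num.min s (f s / (K + 1)).
  have d0 : 0 < d by rewrite lt_min lt_neqAle eq_sym sn0 s0 divr_gt0//; lra.
  have [x [/andP[x0 xt] xZ]] := sup_adherent d0 Zsup.
  rewrite -/s => xs.
  have d1 : d <= s by rewrite ge_min lexx.
  have d2 : d * (K + 1) <= f s by rewrite -ler_pdivlMr ?ge_min ?lexx ?orbT//; lra.
  case: xZ => [x00|fx]; first lra.
  have xs' : x <= s by apply: (ub_le_sup hub) => //; split; [exact/andP|right].
  have := le_trans (ler_norm _) (fK x s x0 xs'); rewrite fx.
  nra.
exists s; split => //.
  rewrite lt_neqAle st andbT; apply/eqP => stE.
  by case: sZ => h; move: ft0 t00; rewrite -stE h ltxx.
move=> x /andP[sx xt]; rewrite lt_neqAle f0 ?andbT; last lra.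
apply/eqP => fx; suff : x <= s by lra.
by apply: (ub_le_sup hub) => //; split; [lra|right].
Qed.

(** If [f t0 > 0], let [s] come from [last_zero]. Cover the exceptional set by an open set of
    measure at most [e]; the Lipschitz bound limits the growth there. Then
    [f t0 <= f s - c (t0 - s) + (K + c) e], which for small [e] is impossible both when [f s = 0]
    and when [s = 0]. *)
Lemma lipschitz_eq0_of_right_decr (R : realType) (f : R -> R) (N : set R)
    (K c t0 : R) :
  (forall t : R, 0 <= t -> 0 <= f t) ->
  (forall s t : R, 0 <= s -> s <= t -> `|f t - f s| <= K * (t - s)) ->
  lebesgue_measure.-negligible N ->
  0 < c ->
  (forall t : R, 0 < t < t0 -> ~ N t -> 0 < f t ->
     exists2 d, 0 < d & forall u, t < u < t + d -> f u <= f t - c * (u - t)) ->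
  0 < t0 -> f 0 < c * t0 -> f t0 = 0.
Proof.
move=> f0 fK negN c0 fd t00 ft0c.
apply/eqP; rewrite eq_le f0 ?(ltW t00)// andbT leNgt; apply/negP => ft0.
have K0 : 0 <= K.
  have := fK _ _ (lexx 0) (ltW t00).
  move=> /(le_trans (normr_ge0 _)); rewrite pmulr_lge0 ?subr_gt0//.
have [s [s0 st sZ fpos]] := last_zero t00 ft0 f0 fK.
have Kc : 0 < K + c by lra.
(* The total correction [(K + c) * e] has to stay below [f t0]. *)
have [e e0 eE] : exists2 e, 0 < e & (K + c) * e < f t0.
  exists (f t0 / (K + c) / 2); first by rewrite !divr_gt0.
  have -> : (K + c) * (f t0 / (K + c) / 2) = f t0 / 2 by field; lra.
  lra.
have [A [mA A0 NA]] := negN.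
have [|U [oU AU Ue]] := lebesgue_regularity_outer mA _ e0.
  by rewrite [X in (X < _)%E]A0.
have mU : measurable U by exact: measurable_realfun.open_measurable.
have {Ue} Ue : (lebesgue_measure U <= e%:E)%E.
  rewrite -(setDUK AU); apply: le_trans (measureU2 _ _ _) _ => //.
    exact: measurableD.
  by rewrite [X in (X + _)%E]A0 add0e ltW.
pose m (a b : R) := lebesgue_measure (U `&` `]a, b]%classic).
have mI a b : measurable (U `&` `]a, b]%classic) by exact: measurableI.
have mle a b : a <= b -> (m a b <= (b - a)%:E)%E.
  move=> ab; apply: (@le_trans _ _ (lebesgue_measure `]a, b]%classic)).
    apply: le_measure; rewrite ?inE;
    [exact: mI|exact: measurable_itv|exact: subIsetr].
  by rewrite lebesgue_measure_itv/=; case: ifP; rewrite ?lee_fin ?subr_ge0.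
have mfin a b : m a b \is a fin_num.
  rewrite ge0_fin_numE ?measure_ge0//; apply: le_lt_trans (ltry e).
  apply: le_trans Ue; apply: le_measure; rewrite ?inE;
    [exact: mI|exact: mU|exact: subIsetl].
pose phi t := fine (m 0 t).
have phi_ge0 t : 0 <= phi t by rewrite fine_ge0// measure_ge0.
have phi_le t : phi t <= e.
  rewrite -lee_fin fineK//; apply: le_trans Ue.
  apply: le_measure; rewrite ?inE;
    [exact: mI|exact: mU|exact: subIsetl].
have phiD (t u : R) : 0 <= t -> t <= u -> phi u - phi t = fine (m t u).
  move=> t0' tu; rewrite /phi.
  suff -> : m 0 u = (m 0%R t + m t u)%E.
    by rewrite fineD// [X in X - _]addrC addrK.
  have itvU : (`]0%R, u] = `]0%R, t] `|` `]t, u])%classic.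
    apply/seteqP; split => x /=; rewrite !in_itv/=.
      by move=> /andP[x0 xu]; have [xt|xt] := leP x t; [left|right];
        rewrite ?x0 ?xu.
    by move=> [] /andP[p q]; apply/andP; split; lra.
  rewrite /m itvU setIUr measureU; [by []|exact: mI|exact: mI|].
  apply/seteqP; split => x //= [[_ +] [_]]; rewrite !in_itv/=.
  by move=> /andP[_ xt] /andP[/lt_le_trans /(_ xt)]; rewrite ltxx.
have phiD0 (t u : R) : 0 <= t -> t <= u -> 0 <= phi u - phi t.
  by move=> ? ?; rewrite phiD// fine_ge0// measure_ge0.
have phiD1 (t u : R) : 0 <= t -> t <= u -> phi u - phi t <= u - t.
  by move=> ? ?; rewrite phiD// -lee_fin fineK// mle.
(* The term in [phi] compensates any growth of [f t + c t] inside [U], where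
   [phi] has slope 1; its total size is at most [(K + c) e]. *)
pose h t := f t + c * t - (K + c) * phi t.
suff : h t0 <= h s.
  rewrite /h; have := phi_le t0; have := phi_ge0 s.
  case: sZ => sZ; rewrite sZ; nra.
apply: (@lipschitz_le_of_right_le _ _ (K + c + (K + c))) => //.
- move=> x y sx xy yt; have x0 : 0 <= x by lra.
  have := fK x y x0 xy; rewrite !ler_norml /h => /andP[].
  by have := phiD0 _ _ x0 xy; have := phiD1 _ _ x0 xy; nra.
- move=> t /andP[stt tt0]; have t0' : 0 < t by lra.
  have [Ut|Ut] := pselect (U t).
    have /nbhs_ballP[d /= d0 dU] : nbhs t U by exact: open_nbhs_nbhs.
    exists d => // u /andP[tu utd].
    suff : phi u - phi t = u - t.
      have := le_trans (ler_norm _) (fK t u (ltW t0') (ltW tu)); rewrite /h; nra.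
    rewrite phiD ?ltW// /m setIidr; last first.
      move=> x /=; rewrite in_itv/= => /andP[tx xu]; apply: dU.
      by rewrite /ball/= ltr_norml; lra.
    by rewrite lebesgue_measure_itv/= lte_fin tu.
  have tt : 0 < t < t0 by lra.
  have tp : s < t <= t0 by lra.
  have [d d0 dP] := fd t tt (fun Nt => Ut (AU _ (NA _ Nt))) (fpos t tp).
  exists d => // u tud; have := dP u tud; case/andP: tud => tu _.
  have := phiD0 _ _ (ltW t0') (ltW tu); rewrite /h; nra.
Qed.

(** * Estimates from the derivative at a point *)

Lemma is_derive1_near (R : realType) (f : R -> R) (t d e : R) :
  is_derive t 1 f d -> 0 < e ->
  exists2 h, 0 < h & forall u, `|u - t| < h ->
    `|f u - f t - d * (u - t)| <= e * `|u - t|.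
Proof.
move=> [df fd] e0; move: df; rewrite /derivable => /cvg_ex[l /= hl].
have ld : l = d.
  by rewrite -fd; apply/esym/cvg_lim; [exact: Rhausdorff|exact: hl].
move/cvgrPdist_le : hl => /(_ e e0); rewrite -nbhs_nearE => /nbhs_ballP.
move=> [h /= h0 hP]; exists h => // u uth.
have [->|ut] := eqVneq u t; first by rewrite !subrr mulr0 subr0 normr0 mulr0.
have utn : u - t != 0 by rewrite subr_eq0.
have := hP (u - t); rewrite /ball/= sub0r normrN => /(_ uth utn).
rewrite ld scaler1 subrK distrC => hu.
rewrite -ler_pdivrMr ?normr_gt0// -normf_div; apply: le_trans hu.
rewrite le_eqVlt; apply/orP; left; apply/eqP; congr (`|_|).
by rewrite -[X in _ = X - _]/(_ * _); field.
Qed.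

Lemma is_derive1_min0 (R : realType) (f : R -> R) (t d : R) :
  is_derive t 1 f d -> 0 < t -> (forall s, 0 <= s -> 0 <= f s) -> f t = 0 ->
  d = 0.
Proof.
move=> fd t0 f0 ft; apply/eqP; rewrite eq_le; apply/andP.
split; rewrite leNgt; apply/negP => d0.
- have [|h h0 hP] := is_derive1_near (e := d / 2) fd; first lra.
  (* The cap [t / 2] keeps [t - k] nonnegative, where the sign of [f] is known. *)
  pose k := Num.min (h / 2) (t / 2).
  have k1 : k <= h / 2 by rewrite ge_min lexx.
  have k2 : k <= t / 2 by rewrite ge_min lexx orbT.
  have k0 : 0 < k by rewrite lt_min; lra.
  have tk : t - k - t = - k by ring.
  have := hP (t - k); rewrite tk ft subr0 normrN gtr0_norm//.
  move=> /(_ ltac:(lra)); rewrite ler_norml => /andP[_].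
  have := f0 (t - k) ltac:(lra); nra.
- have [|h h0 hP] := is_derive1_near (e := - d / 2) fd; first lra.
  have th : t + h / 2 - t = h / 2 by ring.
  have := hP (t + h / 2); rewrite th ft subr0 gtr0_norm ?divr_gt0//.
  move=> /(_ ltac:(lra)); rewrite ler_norml => /andP[_].
  have := f0 (t + h / 2) ltac:(lra); nra.
Qed.

Lemma is_derive1_ndecr_ge0 (R : realType) (f : R -> R) (t d : R) :
  is_derive t 1 f d -> (forall s, t <= s -> f t <= f s) -> 0 <= d.
Proof.
move=> fd fnd; rewrite leNgt; apply/negP => d0.
have [|h h0 hP] := is_derive1_near (e := - d / 2) fd; first lra.
have th : t + h / 2 - t = h / 2 by ring.
have := hP (t + h / 2); rewrite th gtr0_norm ?divr_gt0//.
move=> /(_ ltac:(lra)); rewrite ler_norml => /andP[_].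
have := fnd (t + h / 2) ltac:(lra); nra.
Qed.

(** Only a function attaining the maximum at [t] needs a negative slope, since a strictly smaller
    one cannot catch up at once. Half of the rate [c] is given up to absorb the error of the linear
    approximation. *)
Lemma max_right_decr (R : realType) (f g : R -> R) (t d d' c : R) :
  is_derive t 1 f d -> is_derive t 1 g d' -> 0 < c ->
  (g t <= f t -> d <= - c) -> (f t <= g t -> d' <= - c) ->
  exists2 h, 0 < h & forall u, t < u < t + h ->
    Num.max (f u) (g u) <= Num.max (f t) (g t) - c / 2 * (u - t).
Proof.
wlog gf : f g d d' / g t <= f t => [hw|].
  have /orP[gf|fg] := le_total (g t) (f t); first exact: hw.
  move=> fd gd c0 h1 h2; have [h h0 hP] := hw _ _ _ _ fg gd fd c0 h2 h1.
  by exists h => // u /hP; rewrite maxC [X in _ <= X - _]maxC.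
move=> fd gd c0 /(_ gf) dc d'c.
have c2 : 0 < c / 2 by lra.
have [h h0 hP] := is_derive1_near fd c2.
have [h' h'0 h'P] := is_derive1_near gd c2.
have fu u : t < u -> u < t + h -> f u <= f t - c / 2 * (u - t).
  move=> tu uth; have := hP u; rewrite gtr0_norm ?subr_gt0// => /(_ ltac:(lra)).
  rewrite ler_norml => /andP[_]; nra.
have gu u : t < u -> u < t + h' -> g u <= g t + (d' + c / 2) * (u - t).
  move=> tu uth; have := h'P u; rewrite gtr0_norm ?subr_gt0// => /(_ ltac:(lra)).
  rewrite ler_norml => /andP[_]; nra.
rewrite (max_l gf).
have [fg|fg] := leP (f t) (g t).
  exists (Num.min h h'); first by rewrite lt_min h0.
  move=> u /andP[tu]; rewrite -ltrBlDl lt_min => /andP[uh uh'].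
  have := fu u tu ltac:(lra); have := gu u tu ltac:(lra); have := d'c fg.
  rewrite ge_max => *; apply/andP; split; nra.
(* For a time [k], [g] growing at rate at most [|d'| + c / 2] stays below the line of slope
   [- c / 2] through [f t]. *)
pose k := (f t - g t) / (`|d'| + c).
have k0 : 0 < k by rewrite divr_gt0 ?subr_gt0// ltr_wpDl.
have kE : k * (`|d'| + c) = f t - g t by rewrite divfK// gt_eqF// ltr_wpDl.
exists (Num.min k (Num.min h h')); first by rewrite !lt_min k0 h0.
move=> u /andP[tu]; rewrite -ltrBlDl !lt_min => /and3P[uk uh uh'].
have := fu u tu ltac:(lra); have := gu u tu ltac:(lra); have := ler_norm d'.
have := normr_ge0 d'.
rewrite ge_max => *; apply/andP; split; nra.
Qed.

Lemma is_derive1_affine (R : realType) (K : nat) (T : 'I_K -> R -> R)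
    (tau c : 'I_K -> R) (c0 c1 t : R) :
  (forall i, is_derive t 1 (T i) (tau i)) ->
  is_derive t 1 (fun s => c0 + c1 * s + \sum_i c i * T i s)
    (c1 + \sum_i c i * tau i).
Proof.
move=> Td.
have -> : (fun s => c0 + c1 * s + \sum_i c i * T i s) =
    cst c0 + c1 *: id + \sum_i c i *: T i.
  apply/funext => s; rewrite !fctE /= fct_sumE.
  by congr (_ + _).
have -> : c1 + \sum_i c i * tau i = 0 + c1 *: 1 + \sum_i c i *: tau i.
  by rewrite add0r [c1 *: 1]mulr1.
have lin : is_derive t 1 (cst c0 + c1 *: id) (0 + c1 *: 1) by exact: is_deriveD.
have sum : is_derive t 1 (\sum_i c i *: T i) (\sum_i c i *: tau i).
  by apply: is_derive_sum => i; exact: is_deriveZ.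
exact: is_deriveD lin sum.
Qed.

(** * Open networks and the workload of a group *)

Lemma normr_coord_le (R : realType) (m n : nat) (x : 'M[R]_(m, n)) i j :
  `|x i j| <= `|x|.
Proof.
rewrite {2}/Num.norm/= mx_normrE.
exact: (le_bigmax _ (fun ij : 'I_m * 'I_n => `|x ij.1 ij.2|) (i, j)).
Qed.

Lemma open_network_expr0 (R : realType) (K : nat) (r : 'M[R]_K) (e : R) :
  open_network r -> 0 < e -> exists n, forall i k, `|(r^T ^+ n) i k| < e.
Proof.
move=> /cvg_series_cvg_0 h e0.
have [n _ /(_ n (leqnn n)) /= ne] := cvgr0_norm_lt _ h _ e0.
by exists n => i k; apply: le_lt_trans ne; exact: normr_coord_le.
Qed.

Lemma trmx_expr_ge0 (R : realType) (K : nat) (r : 'M[R]_K) n i k :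
  (forall i k, 0 <= r i k) -> 0 <= (r^T ^+ n) i k.
Proof.
move=> r0; elim: n i k => [|n IH] i k.
  by rewrite expr0 mxE ler0n.
by rewrite exprS mxE sumr_ge0// => j _; rewrite mulr_ge0// mxE.
Qed.

(** Iterating [w >= R^T w] gives [w >= (R^T)^n w], because [R^T] has nonnegative entries, and the
    powers tend to 0. *)
Lemma open_network_ge0 (R : realType) (K : nat) (r : 'M[R]_K) (w : 'cV[R]_K) :
  (forall i k, 0 <= r i k) -> open_network r ->
  (forall k, 0 <= ((1%:M - r^T) *m w) k 0) -> forall k, 0 <= w k 0.
Proof.
move=> r0 ro hw.
have wn n k : ((r^T ^+ n) *m w) k 0 <= w k 0.
  elim: n k => [|n IH] k; first by rewrite expr0 mul1mx.
  apply: le_trans (IH k); rewrite exprSr -subr_ge0.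
  suff -> : ((r^T ^+ n) *m w) k 0 - ((r^T ^+ n * r^T) *m w) k 0 =
            ((r^T ^+ n) *m ((1%:M - r^T) *m w)) k 0.
    by rewrite mxE sumr_ge0// => j _; rewrite mulr_ge0// trmx_expr_ge0.
  by rewrite mulmxBl mul1mx mulmxBr mulmxA mulmxE [RHS]mxE; congr (_ + _);
    rewrite [RHS]mxE.
move=> k; rewrite leNgt; apply/negP => wk.
pose s := \sum_i `|w i 0|.
have s0 : 0 <= s by rewrite sumr_ge0.
(* Once the entries of the power are below this bound, entry [k] of [(R^T)^n w] exceeds [w k 0],
   against [wn]. *)
have e0 : 0 < - w k 0 / (s + 1) by rewrite divr_gt0//; lra.
have [n hn] := open_network_expr0 ro e0.
set e := _ / _ in e0 hn.
have es : e * (s + 1) = - w k 0 by rewrite divfK// gt_eqF//; lra.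
suff : - (e * s) <= ((r^T ^+ n) *m w) k 0 by have := wn n k; nra.
rewrite mxE /s mulr_sumr -sumrN; apply: ler_sum => i _.
rewrite lerNl; apply: le_trans (ler_norm _) _; rewrite normrN normrM.
by rewrite ler_wpM2r// ltW.
Qed.

(** A kernel vector and its negative are both nonnegative by [open_network_ge0]. *)
Lemma open_network_unitmx (R : realType) (K : nat) (r : 'M[R]_K) :
  (forall i k, 0 <= r i k) -> open_network r -> 1%:M - r^T \in unitmx.
Proof.
move=> r0 ro; rewrite -unitmx_tr -row_free_unit; apply: inj_row_free => v v0.
have v0' : (1%:M - r^T) *m v^T = 0 by rewrite -[LHS]trmxK trmx_mul trmxK v0 trmx0.
have vge0 : forall k, 0 <= v^T k 0.
  by apply: (open_network_ge0 r0 ro) => j; rewrite v0' mxE.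
have vle0 : forall k, 0 <= (- v^T) k 0.
  by apply: (open_network_ge0 r0 ro) => j; rewrite mulmxN v0' !mxE oppr0.
apply/rowP => k; rewrite mxE; apply/eqP; rewrite eq_le.
by have := vge0 k; have := vle0 k; rewrite !mxE oppr_ge0 => -> ->.
Qed.

(** The image [w] of [x] solves [w = x + R^T w], and [R^T w >= 0]. *)
Lemma invmx_open_network_ge (R : realType) (K : nat) (r : 'M[R]_K)
    (x : 'cV[R]_K) :
  (forall i k, 0 <= r i k) -> open_network r -> (forall k, 0 <= x k 0) ->
  forall k, x k 0 <= (invmx (1%:M - r^T) *m x) k 0.
Proof.
move=> r0 ro x0; have ru := open_network_unitmx r0 ro.
have [w wE] : exists w, w = invmx (1%:M - r^T) *m x by eexists.
have wx : (1%:M - r^T) *m w = x by rewrite wE mulKVmx.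
rewrite -wE {wE}.
have w0 : forall k, 0 <= w k 0.
  by apply: (open_network_ge0 r0 ro) => k; rewrite wx.
move=> k; rewrite -wx mulmxBl mul1mx mxE gerDl mxE oppr_le0 mxE.
by rewrite sumr_ge0// => i _; rewrite mxE mulr_ge0.
Qed.

(** Otherwise the all-ones vector would lie in the kernel of the invertible matrix [I - R]. *)
Lemma open_network_row_sum_lt1 (R : realType) (K : nat) (r : 'M[R]_K.+1) :
  routing_matrix r -> open_network r -> exists i, \sum_k r i k < 1.
Proof.
move=> [r0 r1] ro; apply/existsP; rewrite -[X in is_true X]negbK negb_exists.
apply/negP => /forallP h.
have := open_network_unitmx r0 ro; rewrite -unitmx_tr => ru.
have rE : (1%:M - r^T)^T *m const_mx 1 = 0 :> 'cV[R]_K.+1.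
  rewrite linearB/= trmx1 trmxK mulmxBl mul1mx; apply/colP => i.
  rewrite !mxE; apply/eqP; rewrite subr_eq0 eq_sym eq_le; apply/andP; split.
    by under eq_bigr do rewrite mxE mulr1; exact: r1.
  by under eq_bigr do rewrite mxE mulr1; rewrite leNgt; exact: h.
have : const_mx 1 = 0 :> 'cV[R]_K.+1 by rewrite -[LHS](mulKmx ru) rE mulmx0.
by move=> /colP /(_ ord0); rewrite !mxE => /eqP; rewrite oner_eq0.
Qed.

(** Pairing [w - R^T w] with the signs of [w] gives the l1 norm of [w] minus at most the l1 mass
    that routing keeps in the network. The signs at zero entries of [w] are left free, which
    [pair_signs] exploits. *)
Lemma signed_sum_ge (R : realType) (K : nat) (r : 'M[R]_K) (w : 'cV[R]_K)
    (e : 'I_K -> R) :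
  (forall i k, 0 <= r i k) ->
  (forall k, `|e k| = 1) -> (forall k, e k * w k 0 = `|w k 0|) ->
  \sum_i `|w i 0| * (1 - \sum_k r i k) <= \sum_k e k * ((1%:M - r^T) *m w) k 0.
Proof.
move=> r0 e1 ew.
have -> : \sum_k e k * ((1%:M - r^T) *m w) k 0 =
    \sum_i (`|w i 0| - \sum_k r i k * (w i 0 * e k)).
  rewrite sumrB exchange_big -sumrB/=; apply: eq_bigr => k _.
  rewrite mulmxBl mul1mx mxE mulrDr ew; congr (_ + _).
  rewrite mxE mulrN mxE mulr_sumr; congr (- _); apply: eq_bigr => i _.
  by rewrite mxE; ring.
apply: ler_sum => i _; rewrite mulrBr mulr1 lerD2l lerN2 mulr_sumr.
apply: ler_sum => k _; rewrite [leRHS]mulrC ler_wpM2l//.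
by apply: le_trans (ler_norm _) _; rewrite normrM e1 mulr1.
Qed.

Definition group_load (R : realType) (K : nat) (r : 'M[R]_K) (mu : 'cV[R]_K)
    (A : {set 'I_K}) (x : 'cV[R]_K) : R :=
  \sum_(i in A) (invmx (1%:M - r^T) *m x) i 0 / mu i 0.

Lemma group_loadD (R : realType) (K : nat) (r : 'M[R]_K) (mu : 'cV[R]_K)
    (A : {set 'I_K}) (x y : 'cV[R]_K) :
  group_load r mu A (x + y) = group_load r mu A x + group_load r mu A y.
Proof.
rewrite /group_load -big_split/=; apply: eq_bigr => i _.
by rewrite mulmxDr mxE mulrDl.
Qed.

Lemma group_loadZ (R : realType) (K : nat) (r : 'M[R]_K) (mu : 'cV[R]_K)
    (A : {set 'I_K}) a (x : 'cV[R]_K) :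
  group_load r mu A (a *: x) = a * group_load r mu A x.
Proof.
rewrite /group_load mulr_sumr; apply: eq_bigr => i _.
by rewrite -scalemxAr mxE mulrA.
Qed.

Lemma group_loadN (R : realType) (K : nat) (r : 'M[R]_K) (mu : 'cV[R]_K)
    (A : {set 'I_K}) (x : 'cV[R]_K) :
  group_load r mu A (- x) = - group_load r mu A x.
Proof. by rewrite -scaleN1r group_loadZ mulN1r. Qed.

Lemma group_load_sum (R : realType) (K : nat) (r : 'M[R]_K) (mu : 'cV[R]_K)
    (A : {set 'I_K}) (I : finType)
    (P : pred I) (x : I -> 'cV[R]_K) :
  group_load r mu A (\sum_(i | P i) x i) = \sum_(i | P i) group_load r mu A (x i).
Proof.
rewrite /group_load exchange_big; apply: eq_bigr => i _.
by rewrite mulmx_sumr summxE mulr_suml.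
Qed.

Lemma group_load_delta (R : realType) (K : nat) (r : 'M[R]_K) (mu : 'cV[R]_K)
    (A : {set 'I_K}) (x : 'cV[R]_K) :
  group_load r mu A x = \sum_k x k 0 * group_load r mu A (delta_mx k 0).
Proof.
rewrite [in LHS](matrix_sum_delta x) group_load_sum; apply: eq_bigr => k _.
by rewrite big_ord1 group_loadZ.
Qed.

Lemma group_load_ge (R : realType) (K : nat) (r : 'M[R]_K) (mu : 'cV[R]_K)
    (A : {set 'I_K}) (x : 'cV[R]_K) :
  (forall i k, 0 <= r i k) -> open_network r -> (forall i, 0 < mu i 0) ->
  (forall k, 0 <= x k 0) ->
  \sum_(i in A) x i 0 / mu i 0 <= group_load r mu A x.
Proof.
move=> r0 ro mu0 x0; apply: ler_sum => i _; apply: ler_wpM2r.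
  by rewrite invr_ge0 ltW.
exact: invmx_open_network_ge.
Qed.

Lemma group_load_ge0 (R : realType) (K : nat) (r : 'M[R]_K) (mu : 'cV[R]_K)
    (A : {set 'I_K}) (x : 'cV[R]_K) :
  (forall i k, 0 <= r i k) -> open_network r -> (forall i, 0 < mu i 0) ->
  (forall k, 0 <= x k 0) -> 0 <= group_load r mu A x.
Proof.
move=> r0 ro mu0 x0; apply: le_trans (group_load_ge A r0 ro mu0 x0).
by rewrite sumr_ge0// => i _; rewrite divr_ge0// ltW.
Qed.

(** Serving a queue only moves later work downstream: it lowers the workload of a group by the
    service time if the queue belongs to the group, and leaves it unchanged otherwise. *)
Lemma group_load_balance (R : realType) (K : nat) (r : 'M[R]_K) (mu : 'cV[R]_K)
    (A : {set 'I_K}) (T : 'cV[R]_K) :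
  (forall i k, 0 <= r i k) -> open_network r -> (forall i, 0 < mu i 0) ->
  group_load r mu A ((1%:M - r^T) *m \col_i (mu i 0 * T i 0)) =
  \sum_(i in A) T i 0.
Proof.
move=> r0 ro mu0; rewrite /group_load mulKmx ?open_network_unitmx//.
by apply: eq_bigr => i _; rewrite mxE mulrC mulKf// gt_eqF.
Qed.

(** * Two groups of two queues *)

Lemma sum4 (R : realType) (F : 'I_4 -> R) :
  \sum_i F i = F (inord 0) + F (inord 1) + (F (inord 2) + F (inord 3)).
Proof.
rewrite !big_ord_recr/= big_ord0 add0r !addrA.
by congr (_ + _ + _ + _); congr F; apply/val_inj; rewrite /= inordK.
Qed.

Lemma sum_two_pairs0 (R : realType) (F : 'I_4 -> R) :
  \sum_(i in two_pairs 0) F i = F (inord 0) + F (inord 1).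
Proof.
by rewrite big_mkcond sum4 /two_pairs eqxx !inE !inordK//= !addr0.
Qed.

Lemma sum_two_pairs1 (R : realType) (F : 'I_4 -> R) :
  \sum_(i in two_pairs 1) F i = F (inord 2) + F (inord 3).
Proof.
by rewrite big_mkcond sum4 /two_pairs/= !inE !inordK//= !add0r.
Qed.

(** The hypothesis excludes that both numbers are positive. A zero gets the sign -1, so the signs
    cancel only when [u] and [v] are strictly opposite. *)
Lemma pair_signs (R : realType) (p q u v : R) :
  0 < p -> 0 < q -> u / p + v / q <= 0 ->
  exists e : R * R, [/\ `|e.1| = 1 /\ `|e.2| = 1,
    e.1 * u = `|u|, e.2 * v = `|v|, e.1 + e.2 <= 0 &
    e.1 + e.2 = 0 -> u != 0 /\ v != 0].
Proof.
move=> p0 q0 uv.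
have up : (0 < u / p) = (0 < u) by rewrite pmulr_lgt0 ?invr_gt0.
have vq : (0 < v / q) = (0 < v) by rewrite pmulr_lgt0 ?invr_gt0.
have [u0|u0] := leP u 0; have [v0|v0] := leP v 0.
- exists (-1, -1); split => /=.
  + by rewrite normrN1.
  + by rewrite mulN1r ler0_norm.
  + by rewrite mulN1r ler0_norm.
  + lra.
  + lra.
- exists (-1, 1); split => /=.
  + by rewrite normrN1 normr1.
  + by rewrite mulN1r ler0_norm.
  + by rewrite mul1r gtr0_norm.
  + lra.
  + rewrite (gt_eqF v0); split=> //; apply/eqP => u00.
    by move: uv; rewrite u00 mul0r add0r leNgt vq v0.
- exists (1, -1); split => /=.
  + by rewrite normrN1 normr1.
  + by rewrite mul1r gtr0_norm.
  + by rewrite mulN1r ler0_norm.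
  + lra.
  + rewrite (gt_eqF u0); split=> //; apply/eqP => v00.
    by move: uv; rewrite v00 mul0r addr0 leNgt up u0.
- move: uv; rewrite -up in u0; rewrite -vq in v0; lra.
Qed.

Definition group_indicator (R : realType) (j : 'I_2) : 'cV[R]_4 :=
  \col_k (k \in two_pairs j)%:R.

Lemma in_two_pairs (k : 'I_4) :
  (k \in two_pairs 0) = (k < 2)%N /\ (k \in two_pairs 1) = (1 < k)%N.
Proof. by rewrite /two_pairs eqxx/= !inE. Qed.

Lemma group_load_det (R : realType) (r : 'M[R]_4) (mu : 'cV[R]_4)
    (V : 'I_2 -> 'cV[R]_4 -> R) :
  V = (fun j => group_load r mu (two_pairs j)) ->
  routing_matrix r -> open_network r -> (forall i, 0 < mu i 0) ->
  V 0 (group_indicator R 1) * V 1 (group_indicator R 0) <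
  V 0 (group_indicator R 0) * V 1 (group_indicator R 1).
Proof.
move=> VE rr ro mu0; have [r0 r1] := rr.
pose ind := group_indicator R.
rewrite -!/(ind _).
have ind0 j k : 0 <= ind j k 0 by rewrite mxE ler0n.
have V0 j j' : 0 <= V j (ind j') by rewrite VE; exact: group_load_ge0.
have indpos j i : i \in two_pairs j -> ind j i 0 = 1 by rewrite mxE => ->.
have V00 : 0 < V 0 (ind 0).
  rewrite VE; apply: lt_le_trans (group_load_ge _ r0 ro mu0 (ind0 0)).
  rewrite sum_two_pairs0 !indpos ?mul1r ?addr_gt0 ?invr_gt0//;
    by rewrite /two_pairs eqxx inE inordK.
have V11 : 0 < V 1 (ind 1).
  rewrite VE; apply: lt_le_trans (group_load_ge _ r0 ro mu0 (ind0 1)).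
  rewrite sum_two_pairs1 !indpos ?mul1r ?addr_gt0 ?invr_gt0//;
    by rewrite /two_pairs/= inE inordK.
rewrite ltNge; apply/negP => hdet.
have V10 : 0 < V 1 (ind 0).
  rewrite lt_neqAle V0 andbT eq_sym; apply/eqP => h.
  by move: hdet; rewrite h mulr0 leNgt mulr_gt0.
(* If the inequality failed, [x] would satisfy [V 1 x = 0] and [V 0 x <= 0]. With
   [w = (I - R^T)^-1 x] this lets the signs of [w] be chosen so that the signed
   sum of the entries of [x] is [<= 0], and it is [0] only if no entry of [w]
   vanishes; [signed_sum_ge] then makes every row sum of [r] equal to 1. *)
pose x : 'cV[R]_4 := V 1 (ind 1) *: ind 0 - V 1 (ind 0) *: ind 1.
have Vx j : V j x = V 1 (ind 1) * V j (ind 0) - V 1 (ind 0) * V j (ind 1).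
  by rewrite VE group_loadD group_loadN !group_loadZ VE.
have xE k : x k 0 = if k \in two_pairs 0 then V 1 (ind 1) else - V 1 (ind 0).
  have kE : (k \in two_pairs 1) = ~~ (k \in two_pairs 0).
    by rewrite /two_pairs eqxx/= !inE -leqNgt.
  rewrite !mxE kE; case: (k \in two_pairs 0) => /=.
    by rewrite mulr1 mulr0 subr0.
  by rewrite mulr1 mulr0 sub0r.
pose w := invmx (1%:M - r^T) *m x.
have wx : (1%:M - r^T) *m w = x by rewrite mulKVmx// open_network_unitmx.
have Vw j : V j x = \sum_(i in two_pairs j) w i 0 / mu i 0 by rewrite VE.
have [e [[e1 e2] eu ev es en]] : exists e : R * R, _ :=
  @pair_signs _ _ _ (w (inord 0) 0) (w (inord 1) 0) (mu0 (inord 0)) (mu0 (inord 1))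
    ltac:(have := Vx 0; rewrite Vw sum_two_pairs0; lra).
(* As [V 1 x = 0], the lemma also applies to [- w]; the signs of [w] then have a nonnegative sum
   here, to match the negative entries of [x]. *)
have [f [[f1 f2] fu fv fs fn]] : exists e : R * R, _ :=
  @pair_signs _ _ _ (- w (inord 2) 0) (- w (inord 3) 0) (mu0 (inord 2)) (mu0 (inord 3))
    ltac:(have := Vx 1; rewrite Vw sum_two_pairs1; lra).
pose s (k : 'I_4) : R := [:: e.1; e.2; - f.1; - f.2]`_k.
have s1 k : `|s k| = 1.
  by case: k => -[|[|[|[|//]]]] i; rewrite /s/= ?normrN.
have sw k : s k * w k 0 = `|w k 0|.
  have : k \in [:: inord 0; inord 1; inord 2; inord 3 : 'I_4].
    by case: k => -[|[|[|[|//]]]] i; rewrite !inE -!val_eqE/= !inordK.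
  rewrite !inE => /or4P[] /eqP ->; rewrite /s inordK//= ?mulNr;
    rewrite -?mulrN ?fu ?fv ?normrN//.
have := signed_sum_ge r0 s1 sw; rewrite wx.
(* The signed sum is [(e.1 + e.2) * V 1 (ind 1) + (f.1 + f.2) * V 1 (ind 0)]. Both coefficients are
   positive and both pair sums are at most 0, so nonnegativity forces each pair sum to vanish. *)
rewrite [X in _ <= X]sum4 !xE /two_pairs eqxx !inE /s !inordK//=.
have [i0 ri0] := open_network_row_sum_lt1 rr ro.
have Si i : 0 <= `|w i 0| * (1 - \sum_k r i k) by rewrite mulr_ge0 ?subr_ge0.
rewrite (bigD1 i0)//=.
have S0 : 0 <= \sum_(i | i != i0) `|w i 0| * (1 - \sum_k r i k).
  by rewrite sumr_ge0.
have [ef|ef] := eqVneq (e.1 + e.2) 0; last first.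
  have := Si i0; nra.
have [ff|ff] := eqVneq (f.1 + f.2) 0; last first.
  have := Si i0; nra.
have {en}[w0 w1] := en ef; have {fn}[w2 w3] := fn ff.
suff : 0 < `|w i0 0| * (1 - \sum_k r i0 k) by nra.
rewrite mulr_gt0 ?subr_gt0// normr_gt0.
have : i0 \in [:: inord 0; inord 1; inord 2; inord 3 : 'I_4].
  by case: i0 {ri0 S0} => -[|[|[|[|//]]]] i; rewrite !inE -!val_eqE/= !inordK.
by rewrite !inE => /or4P[] /eqP -> //; rewrite -oppr_eq0.
Qed.

(** * Drift of the Lyapunov function *)

Lemma group_max_ge (R : realType) (K : nat) (A : {set 'I_K}) (x : 'cV[R]_K) k :
  k \in A -> x k 0 <= group_max A x.
Proof. by move=> kA; exact: (le_bigmax_cond _ (fun k => x k 0)). Qed.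

Lemma longest_queues_rates (R : realType) (K : nat) (A : {set 'I_K})
    (x : 'cV[R]_K) (tau : 'I_K -> R) :
  (forall i, 0 <= tau i) ->
  \sum_(i in longest_queues A x) tau i = 1 ->
  \sum_(i in A :\: longest_queues A x) tau i = 0 ->
  \sum_(i in A) tau i = 1 /\
  forall i k, i \in A -> k \in A -> x i 0 < x k 0 -> tau i = 0.
Proof.
move=> tau0 sum1 sum0; split.
  rewrite (big_setID (longest_queues A x))/= sum0 addr0 -sum1.
  apply: eq_bigl => i.
  by rewrite !inE; case: (i \in A).
move=> i k iA kA xik; apply/eqP; rewrite eq_le tau0 andbT -sum0.
rewrite (bigD1 i)/= ?lerDl ?sumr_ge0// !inE iA andbT/=.
by rewrite lt_eqF//; apply: lt_le_trans xik _; exact: group_max_ge.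
Qed.

(* [x], [y] are the levels of the nonempty group and [dx], [dy] their derivatives;
   [g], [h] are the coefficients of the difference of the two weighted workloads,
   and [b], [c] those of the workload of the nonempty group. *)
Lemma empty_group_drift (R : realType) (b c g h x y dx dy : R) :
  0 <= b -> 0 <= c -> 0 <= x -> 0 <= y -> 0 < x \/ 0 < y ->
  g + h < 0 -> 0 <= x * g + y * h -> dx * b + dy * c < 0 ->
  (y < x -> 0 <= dy) -> (x < y -> 0 <= dx) -> dx * g + dy * h <= 0.
Proof.
wlog yx : b c g h x y dx dy / y <= x => [hw|].
  have /orP[|] := le_total y x; first exact: hw.
  move=> xy b0 c0 x0 y0 xy0 gh gx bc hy hx.
  rewrite addrC; apply: (hw c b h g y x dy dx) => //.
  - by case: xy0; [right|left].
  - by rewrite addrC.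
  - by rewrite addrC.
  - by rewrite addrC.
move=> b0 c0 x0 y0 xy0 gh gx bc hy _.
have xp : 0 < x by case: xy0 => // /lt_le_trans; exact.
have ltyx : y < x.
  rewrite lt_neqAle yx andbT; apply/eqP => yE.
  have : x * (g + h) < 0 by rewrite pmulr_rlt0.
  by move: gx; rewrite yE; nra.
have dy0 := hy ltyx.
(* Otherwise [x * g + y * h = (x - y) * g + y * (g + h)] would be negative. *)
have g0 : 0 <= g.
  rewrite leNgt; apply/negP => g0.
  have : y * (g + h) <= 0 by rewrite mulr_ge0_le0// ltW.
  have : (x - y) * g < 0 by rewrite pmulr_rlt0 ?subr_gt0.
  nra.
have h0 : h <= 0 by lra.
(* The shorter level does not shrink, so the workload can only fall through the longer one. *)
have dx0 : dx <= 0.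
  rewrite leNgt; apply/negP => dx0.
  have : 0 <= dx * b by rewrite mulr_ge0// ltW.
  have : 0 <= dy * c by rewrite mulr_ge0.
  lra.
have : dx * g <= 0 by rewrite mulr_le0_ge0.
have : dy * h <= 0 by rewrite mulr_ge0_le0.
lra.
Qed.

Lemma lq_drift (R : realType) (r : 'M[R]_4) (lambda mu x tau : 'cV[R]_4)
    (eps a b : R) (V : 'I_2 -> 'cV[R]_4 -> R) (dx : 'cV[R]_4) :
  V = (fun j => group_load r mu (two_pairs j)) ->
  dx = lambda - (1%:M - r^T) *m \col_i (mu i 0 * tau i 0) ->
  (forall i k, 0 <= r i k) -> open_network r -> (forall i, 0 <= lambda i 0) ->
  (forall i, 0 < mu i 0) -> 0 < eps -> (forall j, V j lambda <= 1 - eps) ->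
  0 < a -> 0 < b ->
  a * V 0 (group_indicator R 1) < b * V 1 (group_indicator R 1) ->
  b * V 1 (group_indicator R 0) < a * V 0 (group_indicator R 0) ->
  (forall i, 0 <= x i 0) -> (forall i, 0 <= tau i 0) ->
  (forall k, x k 0 = 0 -> dx k 0 = 0) ->
  (forall j, 0 < group_max (two_pairs j) x ->
     \sum_(i in two_pairs j) tau i 0 = 1 /\
     forall i k, i \in two_pairs j -> k \in two_pairs j ->
       x i 0 < x k 0 -> tau i 0 = 0) ->
  x != 0 ->
  (b * V 1 x <= a * V 0 x -> a * V 0 dx <= - (eps * Num.min a b)) /\
  (a * V 0 x <= b * V 1 x -> b * V 1 dx <= - (eps * Num.min a b)).
Proof.
move=> VE dxE r0 ro la0 mu0 eps0 util a0 b0 ab0 ab1 x0 tau0 dx0 lq xn0.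
have [q0 q0E] : exists q : 'I_4, q = inord 0 by eexists.
have [q1 q1E] : exists q : 'I_4, q = inord 1 by eexists.
have [q2 q2E] : exists q : 'I_4, q = inord 2 by eexists.
have [q3 q3E] : exists q : 'I_4, q = inord 3 by eexists.
have [al alE] : exists al, al = fun j k => V j (delta_mx k 0) by eexists.
have Vdx j : V j dx = V j lambda - \sum_(i in two_pairs j) tau i 0.
  by rewrite dxE VE group_loadD group_loadN group_load_balance.
have Vneg j : 0 < group_max (two_pairs j) x -> V j dx <= - eps.
  by move=> /lq[t1 _]; rewrite Vdx t1; have := util j; lra.
have al0 j k : 0 <= al j k.
  by rewrite alE VE; apply: group_load_ge0 => // i; rewrite mxE ler0n.
have Vsum j y : V j y =
    y q0 0 * al j q0 + y q1 0 * al j q1 +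
    (y q2 0 * al j q2 + y q3 0 * al j q3).
  by rewrite q0E q1E q2E q3E alE VE group_load_delta sum4.
have unserved k : tau k 0 = 0 -> 0 <= dx k 0.
  move=> tk; rewrite dxE mulmxBl mul1mx.
  have -> : (lambda - (\col_i (mu i 0 * tau i 0)
      - r^T *m \col_i (mu i 0 * tau i 0))) k 0
    = lambda k 0 + \sum_i r i k * (mu i 0 * tau i 0).
    rewrite !mxE tk mulr0 sub0r opprK; congr (_ + _).
    by apply: eq_bigr => i _; rewrite !mxE.
  rewrite addr_ge0// sumr_ge0// => i _; rewrite !mulr_ge0//; exact: ltW.
have m_le_a : eps * Num.min a b <= eps * a.
  by rewrite ler_wpM2l ?ge_min ?lexx// ltW.
have m_le_b : eps * Num.min a b <= eps * b.
  by rewrite ler_wpM2l ?ge_min ?lexx ?orbT// ltW.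
have gm0 j k : group_max (two_pairs j) x <= 0 -> k \in two_pairs j -> x k 0 = 0.
  move=> g kj; apply/eqP; rewrite eq_le x0 andbT; apply: le_trans g.
  exact: group_max_ge.
have qp0 : q0 \in two_pairs 0 by rewrite (in_two_pairs _).1 q0E inordK.
have qp1 : q1 \in two_pairs 0 by rewrite (in_two_pairs _).1 q1E inordK.
have qp2 : q2 \in two_pairs 1 by rewrite (in_two_pairs _).2 q2E inordK.
have qp3 : q3 \in two_pairs 1 by rewrite (in_two_pairs _).2 q3E inordK.
have gmpos j i k : (forall l, l \in two_pairs j -> l = i \/ l = k) ->
    0 < group_max (two_pairs j) x -> 0 < x i 0 \/ 0 < x k 0.
  move=> jP gm; have [xi|xi] := ltP 0 (x i 0); first by left.
  have [xk|xk] := ltP 0 (x k 0); first by right.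
  move: gm; rewrite ltNge => /negP[]; apply: bigmax_le => // l /jP[] -> //.
have ind1 j : V j (group_indicator R 1) =
    al j q2 + al j q3.
  by rewrite Vsum !mxE !(in_two_pairs _).2 q0E q1E q2E q3E !inordK//=
    !mul0r !mul1r !add0r.
have ind0 j : V j (group_indicator R 0) =
    al j q0 + al j q1.
  by rewrite Vsum !mxE !(in_two_pairs _).1 q0E q1E q2E q3E !inordK//=
    !mul0r !mul1r !addr0.
(* The levels of the empty group and their derivatives vanish, so both workloads and both drifts
   involve only the other two queues. *)
have case0 : group_max (two_pairs 0) x <= 0 -> 0 < group_max (two_pairs 1) x ->
    b * V 1 x <= a * V 0 x -> a * V 0 dx <= b * V 1 dx.
  move=> g0 g1; have V1dx := Vneg _ g1; have [_ lq1] := lq _ g1.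
  have x00 := gm0 _ _ g0 qp0; have x01 := gm0 _ _ g0 qp1.
  have xpos : 0 < x q2 0 \/ 0 < x q3 0.
    apply: gmpos g1 => l; rewrite (in_two_pairs _).2 => l2.
    have [->|l3] := eqVneq l q2; [by left|right].
    apply/val_inj; rewrite /= q3E inordK//.
    have := ltn_ord l; move: l3; rewrite -val_eqE/= q2E inordK//.
    by case: (val l) l2 => [|[|[|[|]]]].
  have dx00 := dx0 _ x00; have dx01 := dx0 _ x01.
  have drift := @empty_group_drift R (al 1 q2) (al 1 q3)
    (a * al 0 q2 - b * al 1 q2)
    (a * al 0 q3 - b * al 1 q3)
    (x q2 0) (x q3 0) (dx q2 0) (dx q3 0)
    (al0 _ _) (al0 _ _) (x0 _) (x0 _) xpos.
  move: V1dx ab0; rewrite !ind1 !Vsum x00 x01 dx00 dx01 !mul0r !add0r => V1dx ab0 Vx.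
  suff : dx q2 0 * (a * al 0 q2 - b * al 1 q2) +
    dx q3 0 * (a * al 0 q3 - b * al 1 q3) <= 0 by lra.
  apply: drift; [lra|lra|lra| |].
  - by move=> h; apply: unserved; exact: (lq1 _ _ qp3 qp2 h).
  - by move=> h; apply: unserved; exact: (lq1 _ _ qp2 qp3 h).
have case1 : group_max (two_pairs 1) x <= 0 -> 0 < group_max (two_pairs 0) x ->
    a * V 0 x <= b * V 1 x -> b * V 1 dx <= a * V 0 dx.
  move=> g1 g0; have V0dx := Vneg _ g0; have [_ lq0] := lq _ g0.
  have x12 := gm0 _ _ g1 qp2; have x13 := gm0 _ _ g1 qp3.
  have xpos : 0 < x q0 0 \/ 0 < x q1 0.
    apply: gmpos g0 => l; rewrite (in_two_pairs _).1 => l2.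
    have [->|l3] := eqVneq l q0; [by left|right].
    apply/val_inj; rewrite /= q1E inordK//.
    move: l3; rewrite -val_eqE/= q0E inordK//.
    by case: (val l) l2 => [|[|]].
  have dx12 := dx0 _ x12; have dx13 := dx0 _ x13.
  have drift := @empty_group_drift R (al 0 q0) (al 0 q1)
    (b * al 1 q0 - a * al 0 q0)
    (b * al 1 q1 - a * al 0 q1)
    (x q0 0) (x q1 0) (dx q0 0) (dx q1 0)
    (al0 _ _) (al0 _ _) (x0 _) (x0 _) xpos.
  move: V0dx ab1; rewrite !ind0 !Vsum x12 x13 dx12 dx13 !mul0r !addr0 => V0dx ab1 Vx.
  suff : dx q0 0 * (b * al 1 q0 - a * al 0 q0) +
    dx q1 0 * (b * al 1 q1 - a * al 0 q1) <= 0 by lra.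
  apply: drift; [lra|lra|lra| |].
  - by move=> h; apply: unserved; exact: (lq0 _ _ qp1 qp0 h).
  - by move=> h; apply: unserved; exact: (lq0 _ _ qp0 qp1 h).
have aV : 0 < group_max (two_pairs 0) x -> a * V 0 dx <= - (eps * Num.min a b).
  by move=> /Vneg /(ler_wpM2l (ltW a0)); lra.
have bV : 0 < group_max (two_pairs 1) x -> b * V 1 dx <= - (eps * Num.min a b).
  by move=> /Vneg /(ler_wpM2l (ltW b0)); lra.
have [g0|g0] := leP (group_max (two_pairs 0) x) 0;
  have [g1|g1] := leP (group_max (two_pairs 1) x) 0.
- case/eqP : xn0; apply/colP => k; rewrite mxE.
  have [k2|k2] := ltnP k 2.
    by apply: (gm0 0) => //; rewrite (in_two_pairs _).1.
  by apply: (gm0 1) => //; rewrite (in_two_pairs _).2.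
- by split=> [/(case0 g0 g1) h|_]; [exact: le_trans h (bV g1)|exact: bV].
- by split=> [_|/(case1 g1 g0) h]; [exact: aV|exact: le_trans h (aV g0)].
- by split=> _; [exact: aV|exact: bV].
Qed.

(** * Regularity of fluid solutions and stability *)

Lemma fluid_balance_mx (R : realType) (K J : nat) (r : 'M[R]_K)
    (lambda mu : 'cV[R]_K) (G : 'I_J -> {set 'I_K}) (X T : R -> 'cV[R]_K) t :
  fluid_solution r lambda mu G X T -> 0 <= t ->
  X t = X 0 + t *: lambda - (1%:M - r^T) *m \col_i (mu i 0 * T t i 0).
Proof.
move=> XT t0; apply/colP => k; rewrite (fluid_balance XT k t0).
rewrite mulmxBl mul1mx !mxE opprB addrA addrAC [t * _]mulrC.
congr (_ + _ + _); apply: eq_bigr => i _.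
by rewrite !mxE mulrA.
Qed.

Lemma max_sub_le (R : realType) (x y x' y' d : R) :
  `|x' - x| <= d -> `|y' - y| <= d -> `|Num.max x' y' - Num.max x y| <= d.
Proof.
rewrite !ler_norml => /andP[? ?] /andP[? ?].
by case: (leP x' y'); case: (leP x y); lra.
Qed.

Lemma fluid_time_sub (R : realType) (r : 'M[R]_4) (lambda mu : 'cV[R]_4)
    (X T : R -> 'cV[R]_4) s t i :
  fluid_solution r lambda mu two_pairs X T -> 0 <= s -> s <= t ->
  T s i 0 <= T t i 0 /\ T t i 0 - T s i 0 <= t - s.
Proof.
move=> XT s0 st; have Tn k := fluid_time_ndecr XT k s0 st; split => //.
have [j ij] : exists j, i \in two_pairs j.
  have [i2|i2] := ltnP i 2.
    by exists 0; rewrite (in_two_pairs _).1.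
  by exists 1; rewrite (in_two_pairs _).2.
apply: le_trans (fluid_capacity XT j s0 st).
by rewrite (bigD1 i)//= lerDl sumr_ge0// => k _; rewrite subr_ge0.
Qed.

Lemma fluid_not_derivable_negligible (R : realType) (r : 'M[R]_4)
    (lambda mu : 'cV[R]_4) (X T : R -> 'cV[R]_4) (M : R) :
  fluid_solution r lambda mu two_pairs X T -> 0 < M ->
  lebesgue_measure.-negligible
    [set t | 0 < t < M /\ ~ forall i, derivable (fun s => T s i 0) t 1].
Proof.
move=> XT M0.
(* [inord] lets the natural numbers enumerate the four queues, so that countable subadditivity
   applies. *)
pose N (n : nat) := [set t | 0 < t < M /\
  ~ derivable (fun s => T s (inord n : 'I_4) 0) t 1]%classic.
have : lebesgue_measure.-negligible (\bigcup_n N n)%classic.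
  apply: negligible_bigcup => n.
  apply: lipschitz_nondecreasing_derivable_ae => // s t s0 st.
  exact: fluid_time_sub XT s0 st.
apply: negligibleS => t [tM /existsNP[i nd]].
by exists (nat_of_ord i); [|rewrite /N/= inord_val].
Qed.

Theorem theorem3p1 (R : realType) (r : 'M[R]_4) (lambda mu : 'cV[R]_4)
    (hrouting : routing_matrix r)
    (hopen : open_network r)
    (hlambda : forall i, 0 <= lambda i 0)
    (hmu : forall i, 0 < mu i 0)
    (hutil : utilization_condition r lambda mu two_pairs) :
  lq_fluid_stable r lambda mu two_pairs.
Proof.
have r0 := hrouting.1; have [eps eps0 util] := hutil.
have [V VE] : exists V, V = fun j => group_load r mu (two_pairs j) by eexists.
have utilV j : V j lambda <= 1 - eps by rewrite VE; exact: util.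
have V0 j (x : 'cV[R]_4) : (forall k, 0 <= x k 0) -> 0 <= V j x.
  by move=> x0; rewrite VE; exact: group_load_ge0.
have det : V 0 (group_indicator R 1) * V 1 (group_indicator R 0) <
    V 0 (group_indicator R 0) * V 1 (group_indicator R 1).
  exact: group_load_det VE hrouting hopen hmu.
have ind0 j k : 0 <= group_indicator R j k 0 by rewrite mxE ler0n.
have V00 := V0 0 _ (ind0 0); have V01 := V0 0 _ (ind0 1).
have V10 := V0 1 _ (ind0 0); have V11 := V0 1 _ (ind0 1).
(* These weights equalize the two weighted workloads of the all-ones vector. Each of [ab1] and [ab0]
   then reduces, after cancellation, to [det]. *)
have [a aE] : exists a,
  a = V 1 (group_indicator R 0) + V 1 (group_indicator R 1) by eexists.
have [b bE] : exists b,
  b = V 0 (group_indicator R 0) + V 0 (group_indicator R 1) by eexists.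
have a0 : 0 < a.
  rewrite aE lt_neqAle eq_sym paddr_eq0// addr_ge0// andbT; apply/negP.
  by move=> /andP[/eqP h1 /eqP h2]; move: det; rewrite h1 h2 !mulr0 ltxx.
have b0 : 0 < b.
  rewrite bE lt_neqAle eq_sym paddr_eq0// addr_ge0// andbT; apply/negP.
  by move=> /andP[/eqP h1 /eqP h2]; move: det; rewrite h1 h2 !mul0r ltxx.
have ab1 : a * V 0 (group_indicator R 1) < b * V 1 (group_indicator R 1).
  by rewrite aE bE; nra.
have ab0 : b * V 1 (group_indicator R 0) < a * V 0 (group_indicator R 0).
  by rewrite aE bE; nra.
pose m := eps * Num.min a b.
have m0 : 0 < m by rewrite mulr_gt0// lt_min a0.
have m20 : 0 < m / 2 by rewrite divr_gt0.
pose C := a * \sum_k V 0 (delta_mx k 0) + b * \sum_k V 1 (delta_mx k 0).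
have al0 j k : 0 <= V j (delta_mx k 0) by apply: V0 => i; rewrite mxE ler0n.
have C0 : 0 <= C by rewrite addr_ge0// mulr_ge0 ?(ltW a0) ?(ltW b0)// sumr_ge0.
(* [C] bounds the initial value of the Lyapunov function when all levels are at most 1. The rate is
   [m / 2] because [max_right_decr] keeps half of [m]; the added 1 keeps the time positive even if
   [C] is 0. *)
exists ((C + 1) / (m / 2)); first by rewrite divr_gt0//; lra.
move=> X T [XT lq] X0 t; rewrite ltr_pdivrMr// => Ct.
have t0 : 0 < t by rewrite -(pmulr_lgt0 _ m20); lra.
have Xge0 s k : 0 <= s -> 0 <= X s k 0 by exact: (fluid_level_ge0 XT).
have VX j s : 0 <= s ->
    V j (X s) = V j (X 0) + V j lambda * s
    + \sum_i - (i \in two_pairs j)%:R * T s i 0.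
  move=> s0; rewrite [in LHS](fluid_balance_mx XT s0) VE.
  rewrite !group_loadD group_loadZ group_loadN group_load_balance//.
  rewrite [s * _]mulrC; congr (_ + _); rewrite big_mkcond -sumrN/=.
  by apply: eq_bigr => i _; case: ifP => _; rewrite ?mulN1r// oppr0 mul0r.
(* Work arrives at a rate in [[0, 1 - eps]] and is removed at a mean rate in [[0, 1]], so the
   difference has slope at most 1 in absolute value. *)
have VXsub j s u : 0 <= s -> s <= u -> `|V j (X u) - V j (X s)| <= u - s.
  move=> s0 su; rewrite (VX j u (le_trans s0 su)) (VX j s s0).
  have -> : V j (X 0) + V j lambda * u + \sum_i - (i \in two_pairs j)%:R * T u i 0
    - (V j (X 0) + V j lambda * s + \sum_i - (i \in two_pairs j)%:R * T s i 0)
    = V j lambda * (u - s) - \sum_(i in two_pairs j) (T u i 0 - T s i 0).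
    rewrite [in RHS]big_mkcond/=.
    have -> : \sum_i (if i \in two_pairs j then T u i 0 - T s i 0 else 0) =
      \sum_i - (i \in two_pairs j)%:R * T s i 0
      - \sum_i - (i \in two_pairs j)%:R * T u i 0.
      rewrite -sumrB; apply: eq_bigr => i _.
      by case: ifP => _; rewrite ?oppr0 ?mul0r ?subrr ?mulN1r ?opprK// addrC.
    ring.
  have c1 := fluid_capacity XT j s0 su.
  have c0 : 0 <= \sum_(i in two_pairs j) (T u i 0 - T s i 0).
    by apply: sumr_ge0 => i _; rewrite subr_ge0; exact: (fluid_time_ndecr XT).
  have vl := V0 j _ hlambda; have vu := utilV j.
  rewrite ler_norml; apply/andP; split; nra.
pose f s := Num.max (a * V 0 (X s)) (b * V 1 (X s)).
have f0 s : 0 <= s -> 0 <= f s.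
  move=> s0; rewrite le_max mulr_ge0// ?(ltW a0)// V0// => k; exact: Xge0.
(* A workload dominates the work present in the group's own queues, so a group without workload is
   empty. *)
have fX s : 0 <= s -> f s <= 0 -> X s = 0.
  move=> s0; rewrite /f ge_max pmulr_rle0// pmulr_rle0// => /andP[v0 v1].
  have Vj j : V j (X s) <= 0 -> forall k, k \in two_pairs j -> X s k 0 = 0.
    move=> vj k kj.
    have h : \sum_(i in two_pairs j) X s i 0 / mu i 0 <= 0.
      apply: le_trans vj; rewrite VE; apply: group_load_ge => // l; exact: Xge0.
    have Xmu i : 0 <= X s i 0 / mu i 0 by rewrite divr_ge0 ?Xge0// ltW.
    apply/eqP; rewrite eq_le Xge0// andbT.
    rewrite -(@pmulr_lle0 _ (mu k 0)^-1) ?invr_gt0//.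
    by apply: le_trans h; rewrite (bigD1 k)//= lerDl sumr_ge0.
  apply/colP => k; rewrite mxE.
  have [k2|k2] := ltnP k 2.
    by apply: (Vj 0) => //; rewrite (in_two_pairs _).1.
  by apply: (Vj 1) => //; rewrite (in_two_pairs _).2.
apply: fX; first exact: ltW.
suff -> : f t = 0 by [].
apply: (@lipschitz_eq0_of_right_decr _ f _ (a + b) (m / 2) t f0 _
  (fluid_not_derivable_negligible XT t0)) => //.
- move=> s u s0 su.
  apply: max_sub_le; rewrite -mulrBr normrM gtr0_norm//;
    apply: le_trans (ler_wpM2l _ (VXsub _ _ _ s0 su)) _; rewrite ?(ltW a0) ?(ltW b0)//;
    by rewrite ler_wpM2r ?subr_ge0// ?lerDl ?lerDr ltW.
- move=> s /andP[s0 st] nN fs.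
  have Td : forall i, derivable (fun s => T s i 0) s 1.
    by apply: contrapT => h; apply: nN; split => //; apply/andP.
  pose tau : 'cV[R]_4 := \col_i derive1 (fun s => T s i 0) s.
  have Tdd i : is_derive s 1 (fun s => T s i 0) (tau i 0).
    by rewrite mxE derive1E; apply/derivableP.
  pose dx := lambda - (1%:M - r^T) *m \col_i (mu i 0 * tau i 0).
  (* The affine expression in [T] is differentiated in place of [c * V j (X u)], with which it is
     known to agree only for [u >= 0]. *)
  have VF j c : is_derive s 1 (fun u => c * (V j (X 0)) + c * V j lambda * u +
      \sum_i c * - (i \in two_pairs j)%:R * T u i 0) (c * V j dx).
    have -> : c * V j dx = c * V j lambda +
        \sum_i c * - (i \in two_pairs j)%:R * tau i 0.
      rewrite /dx VE group_loadD group_loadN group_load_balance// mulrDr.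
      congr (_ + _); rewrite big_mkcond -sumrN mulr_sumr; apply: eq_bigr => i _.
      by case: ifP => _; rewrite ?oppr0 ?mulr0 ?mul0r// mulrN1 mulrN mulNr.
    exact: (is_derive1_affine (T := fun i u => T u i 0)).
  have VFE j c u : 0 <= u -> c * (V j (X 0)) + c * V j lambda * u +
      \sum_i c * - (i \in two_pairs j)%:R * T u i 0 = c * V j (X u).
    move=> u0; rewrite (VX j u u0) !mulrDr mulrA mulr_sumr; congr (_ + _).
    by apply: eq_bigr => i _; rewrite mulrA.
  (* A level that vanishes at a positive time has a minimum there. *)
  have dxk k : X s k 0 = 0 -> dx k 0 = 0.
    move=> xk.
    have : is_derive s 1 (fun u => X 0 k 0 + lambda k 0 * u +
        \sum_i (r i k * mu i 0 - (i == k)%:R * mu i 0) * T u i 0) (dx k 0).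
      have -> : dx k 0 = lambda k 0 +
          \sum_i (r i k * mu i 0 - (i == k)%:R * mu i 0) * tau i 0.
        rewrite mxE; congr (_ + _); rewrite mxE mxE -sumrN; apply: eq_bigr => i _.
        rewrite !mxE [k == i]eq_sym; ring.
      exact: (is_derive1_affine (T := fun i u => T u i 0)).
    have FE u : 0 <= u -> X 0 k 0 + lambda k 0 * u +
        \sum_i (r i k * mu i 0 - (i == k)%:R * mu i 0) * T u i 0 = X u k 0.
      move=> u0; rewrite (fluid_balance XT k u0).
      have -> : \sum_i (r i k * mu i 0 - (i == k)%:R * mu i 0) * T u i 0 =
          \sum_i r i k * mu i 0 * T u i 0 - mu k 0 * T u k 0.
        under eq_bigr do rewrite mulrBl.
        rewrite sumrB; congr (_ - _); rewrite (bigD1 k)//= eqxx mul1r big1 ?addr0//.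
        by move=> i /negbTE ->; rewrite !mul0r.
      ring.
    move=> /is_derive1_min0 -> //.
    - by move=> u u0; rewrite FE// Xge0.
    - by rewrite FE// ltW.
  have tau0 i : 0 <= tau i 0.
    apply: is_derive1_ndecr_ge0 (Tdd i) _ => u su.
    exact: (fluid_time_ndecr XT) (ltW s0) su.
  have Xn0 : X s != 0.
    apply/eqP => Xs; move: fs; rewrite /f Xs.
    have Vz j : V j 0 = 0.
      by rewrite VE -(scale0r (0 : 'cV[R]_4)) group_loadZ mul0r.
    by rewrite !Vz !mulr0 maxxx ltxx.
  have lq' j : 0 < group_max (two_pairs j) (X s) ->
     \sum_(i in two_pairs j) tau i 0 = 1 /\
     forall i k, i \in two_pairs j -> k \in two_pairs j ->
       X s i 0 < X s k 0 -> tau i 0 = 0.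
    move=> gm; have [h1 h2] := lq s s0 Td j gm.
    apply: longest_queues_rates => //.
    - by rewrite -[RHS]h1; apply: eq_bigr => i _; rewrite mxE.
    - by rewrite -[RHS]h2; apply: eq_bigr => i _; rewrite mxE.
  have [d0 d1] := lq_drift VE erefl r0 hopen hlambda hmu eps0 utilV a0 b0 ab1 ab0
    (fun k => Xge0 s k (ltW s0)) tau0 dxk lq' Xn0.
  have := max_right_decr (VF 0 a) (VF 1 b) m0.
  rewrite !(VFE _ _ _ (ltW s0)) => /(_ d0 d1)[h h0 hP].
  exists h => // u /andP[su uh].
  have u0 : 0 <= u by exact: le_trans (ltW s0) (ltW su).
  by have := hP u ltac:(by apply/andP); rewrite !(VFE _ _ _ u0).
- have X0k k : X 0 k 0 <= 1.
    by apply: le_trans X0; apply: le_trans (ler_norm _) (normr_coord_le _ _ _).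
  have VX0 j : V j (X 0) <= \sum_k V j (delta_mx k 0).
    rewrite VE group_load_delta; apply: ler_sum => k _.
    by rewrite ler_piMl//; have := al0 j k; rewrite VE.
  suff : f 0 <= C by lra.
  have v0 : a * V 0 (X 0) <= a * \sum_k V 0 (delta_mx k 0).
    by rewrite ler_wpM2l// ltW.
  have v1 : b * V 1 (X 0) <= b * \sum_k V 1 (delta_mx k 0).
    by rewrite ler_wpM2l// ltW.
  have w0 : 0 <= a * \sum_k V 0 (delta_mx k 0).
    by rewrite mulr_ge0 ?(ltW a0) ?(ltW b0)// sumr_ge0.
  have w1 : 0 <= b * \sum_k V 1 (delta_mx k 0).
    by rewrite mulr_ge0 ?(ltW a0) ?(ltW b0)// sumr_ge0.
  by rewrite ge_max /C; apply/andP; split; lra.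
Qed.
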